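(* In the wireless backhaul network model below, consider the long-hop (beamforming) strategy: every hop is a single-stream eigen-beamformed MIMO link between two BSs, each hop must achieve received SNR at least a fixed target $P_0>0$ (independent of $n$), and every BS transmits at a rate bounded by a constant independent of $n$, which it shares among all connections it relays. Then for every $\epsilon>0$, with high probability, the worst-case per source–destination rate satisfies $$R(n)=O\!\left(\frac{\Psi(n)^{\frac{2}{\alpha}}}{n^{\frac12-\epsilon}}\right).$$
   Context: Model: base stations (BSs) are the points of a homogeneous Poisson point process of finite density $\lambda_{\rm b}>0$ restricted to the box $B_n=[0,\sqrt{n}]^2$; source–destination pairs are chosen uniformly at random so each BS is the source of one pair and destination of exactly one pair. Each BS has $\Psi(n)$ antennas ($\Psi$ non-decreasing) and transmit power at most $P$; noise power and bandwidth are $1$. For a link of BS separation $d>1$ with $\Psi(n)\times\Psi(n)$ channel matrix $\mathbf{H}$ with entries $h_{ik}=\sqrt{\min\{1,d^{-\alpha}\}}\exp(j\theta_{ik})$ ($\alpha>2$, arbitrary phases), single-stream eigen-beamforming achieves received SNR $P\lambda_{\max}(\mathbf{H}\mathbf{H}^\dagger)\le P d^{-\alpha}\Psi(n)^2$; thus the SNR target forces each hop length to satisfy $d\le d_{\rm c}=(P/P_0)^{1/\alpha}\Psi(n)^{2/\alpha}$. $R(n)$ is the worst-case rate over all source–destination pairs. $f(n)=O(g(n))$ w.h.p. means there exists a constant $K$ independent of $n$ with $\lim_{n\to\infty}\mathbb{P}(f(n)\le Kg(n))=1$. *)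

(* Defs.v *)
From HB Require Import structures.
From mathcomp Require Import all_boot all_order all_algebra all_fingroup.
From mathcomp Require Import all_classical all_reals all_analysis.
Set Implicit Arguments. Unset Strict Implicit. Unset Printing Implicit Defensive.
Import Order.TTheory GRing.Theory Num.Theory.
Local Open Scope classical_set_scope.
Local Open Scope ring_scope.

Definition dist2 {R : realType} (p q : R * R) : R :=
  Num.sqrt ((p.1 - q.1) ^+ 2 + (p.2 - q.2) ^+ 2).

(* A hop between BSs at positions p, q is admissible iff the eigen-beamforming
   SNR upper bound  P * min(1, d^-alpha) * Psi^2  reaches the target P0,
   written equivalently (and without division by d = 0) as
   P0 * max(1, d^alpha) <= P * Psi^2. *)
Definition hop_ok {R : realType} (P P0 alpha : R) (Psi : nat) (p q : R * R) : bool :=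
  P0 * Num.max 1 (dist2 p q `^ alpha) <= P * (Psi%:R) ^+ 2.

(* A routing scheme for k BSs at positions ps with pairing sigma (BS i is the
   source of the pair whose destination is sigma i):
   route i = the BSs visited after the source i, ending at sigma i, all hops
   admissible; r i >= 0 is the rate of pair i; every BS j transmits at total
   rate at most C, where BS j transmits (as source or relay) for pair i once
   per occurrence of j in belast i (route i). *)
Definition feasible_scheme {R : realType} (k : nat) (sigma : 'S_k) (ps : seq (R * R))
    (P P0 alpha : R) (Psi : nat) (C : R)
    (route : 'I_k -> seq 'I_k) (r : 'I_k -> R) : Prop :=
  [/\ (forall i : 'I_k,
         path (fun a b : 'I_k => hop_ok P P0 alpha Psi (nth (0, 0) ps a) (nth (0, 0) ps b))
              i (route i)
         /\ last i (route i) = sigma i),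
      (forall i : 'I_k, 0 <= r i)
    & (forall j : 'I_k, \sum_(i < k) r i * (count_mem j (belast i (route i)))%:R <= C)].

Definition worst_rate_le {R : realType} (k : nat) (sigma : 'S_k) (ps : seq (R * R))
    (P P0 alpha : R) (Psi : nat) (C t : R) : Prop :=
  forall route r, feasible_scheme sigma ps P P0 alpha Psi C route r ->
    exists i : 'I_k, r i <= t.

Fixpoint box_int {R : realType} (s : R) (k : nat) (f : seq (R * R) -> \bar R) : \bar R :=
  match k with
  | 0 => f [::]
  | k'.+1 =>
    (\int[@lebesgue_measure R]_(x in `[0%R, s]%classic)
       \int[@lebesgue_measure R]_(y in `[0%R, s]%classic)
          box_int s k' (fun ps => f ((x, y) :: ps)))%E
  end.

(* Probability of the event E(k, sigma, ps) when the BSs are a homogeneous PPP of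
   density lam on B_n = [0, sqrt n]^2 (Poisson(lam n) many i.i.d. uniform points)
   and the pairing sigma is a uniformly random permutation of the BSs. *)
Definition ppp_perm_prob {R : realType} (lam : R) (n : nat)
    (E : forall k : nat, 'S_k -> seq (R * R) -> Prop) : \bar R :=
  (\sum_(0 <= k <oo)
     ((expR (- (lam * n%:R)) * (lam * n%:R) ^+ k / (k`!)%:R) / (k`!)%:R / (n%:R) ^+ k)%:E
     * \sum_(s : 'S_k) box_int (Num.sqrt n%:R) k (fun ps => ((asbool (E k s ps))%:R)%:E))%E.

(* Main.v *)
(** Summing the per-station rate constraints bounds the total of (rate of a pair)
    x (hops of its route) by C k, and a route whose ends are at distance rho has
    at least rho / d_c hops.  Hence the worst rate is at most 2 C d_c / rho as
    soon as fewer than half of the pairs have ends closer than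
    rho = n^(1/2 - eps).  The slack n^eps makes Markov's inequality enough for
    that: comparing only abscissas, a pair is a fixed point (probability 1/k) or
    is close with probability at most 2 rho / sqrt n = 2 n^(-eps).  The rate event
    is not known to be measurable, so the iterated integrals are bounded below
    by integrating a measurable minorant, one point at a time. *)

Require Import Defs.
From HB Require Import structures.
From mathcomp Require Import all_boot all_order all_algebra all_fingroup.
From mathcomp Require Import all_classical all_reals all_analysis.
From mathcomp Require Import measurable_realfun ring lra.
Set Implicit Arguments. Unset Strict Implicit. Unset Printing Implicit Defensive.
Import Order.TTheory GRing.Theory Num.Theory.
Import numFieldNormedType.Exports.
Local Open Scope classical_set_scope.
Local Open Scope ring_scope.

(** * Monotonicity of the integral for nonmeasurable functions *)

(** The integral of a nonnegative function is a supremum over the simple functions below it, and a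
    larger function has more of them below it. *)
Lemma ge0_le_integral_nonmeasurable d (T : measurableType d) (R : realType)
    (mu : {measure set T -> \bar R}) (D : set T) (f g : T -> \bar R) :
  (forall x, D x -> (0 <= f x)%E) -> (forall x, D x -> (f x <= g x)%E) ->
  (\int[mu]_(x in D) f x <= \int[mu]_(x in D) g x)%E.
Proof.
move=> f0 fg.
have g0 x : D x -> (0 <= g x)%E by move=> Dx; exact: le_trans (f0 _ Dx) (fg _ Dx).
rewrite !ge0_integralE//; apply: ereal_sup_le => _ [h /= hf <-].
exists h => //= x; apply: (le_trans (hf x)).
by rewrite !patchE; case: ifPn => //; rewrite inE => /fg.
Qed.

(** * Fixed points of a uniform permutation *)

(** Right multiplication by [tperm k j] carries the permutations sending [i] to [k] onto those
    sending [i] to [j], so the values of [s i] split the group into [#|T|] classes of equal size. *)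
Lemma card_perm_maps_to (T : finType) (i j : T) :
  (#|[set s : {perm T} | s i == j]%SET| * #|T|)%N = (#|T|)`!.
Proof.
have cst k : #|[set s : {perm T} | s i == k]%SET| = #|[set s : {perm T} | s i == j]%SET|.
  rewrite -(card_imset _ (mulIg (tperm k j))).
  apply: eq_card => s; rewrite inE; apply/imsetP/eqP.
    by move=> [t]; rewrite inE => /eqP ti ->; rewrite permM ti tpermL.
  move=> si; exists (s * tperm k j)%g; last by rewrite -mulgA tperm2 mulg1.
  by rewrite inE permM si tpermR.
have -> : (#|T|)`! = #|{perm T}|.
  have := card_perm [set: T]; rewrite cardsT => <-.
  by apply: eq_card => s; rewrite unfold_in /perm_on; apply/fintype.subsetP => x; rewrite inE.
rewrite -[RHS]sum1_card (partition_big (fun s : {perm T} => s i) xpredT)//=.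
rewrite (eq_bigr (fun=> #|[set s : {perm T} | s i == j]%SET|)); last first.
  by move=> k _; rewrite sum1dep_card (cst k).
by rewrite sum_nat_const mulnC.
Qed.

(** Double counting of the pairs of a permutation and a point that it fixes: the mean number of
    fixed points is 1. *)
Lemma sum_fixed_points_perm (T : finType) :
  (0 < #|T|)%N -> (\sum_(s : {perm T}) #|[set i | s i == i]%SET|)%N = (#|T|)`!.
Proof.
move=> T0.
under eq_bigr do rewrite -sum1dep_card big_mkcond.
rewrite exchange_big/=.
apply/eqP; rewrite -(eqn_pmul2r T0) big_distrl/=; apply/eqP.
under eq_bigr do rewrite -big_mkcond sum1dep_card card_perm_maps_to.
by rewrite sum_nat_const mulnC.
Qed.

(** * Iterated integrals over the box *)

Lemma integral_itv_cst (R : realType) (s c : R) : 0 <= s ->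
  (\int[@lebesgue_measure R]_(x in `[0%R, s]) c%:E)%E = (s * c)%:E.
Proof.
move=> s0; rewrite integral_cst//= lebesgue_measure_itv/= lte_fin.
case: ltP => s0'; first by rewrite sube0 -EFinM mulrC.
have -> : s = 0 by apply/eqP; rewrite eq_le s0 s0'.
by rewrite mule0 mul0r.
Qed.

Lemma box_int_ge0 (R : realType) (s : R) (k : nat) (f : seq (R * R) -> \bar R) :
  (forall ps, (0 <= f ps)%E) -> (0 <= box_int s k f)%E.
Proof.
elim: k f => [|k IH] f f0 //=.
by apply: integral_ge0 => x _; apply: integral_ge0 => y _; exact: IH.
Qed.

Lemma box_int_le1 (R : realType) (s : R) (k : nat) (f : seq (R * R) -> \bar R) :
  0 <= s -> (forall ps, (0 <= f ps <= 1)%E) ->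
  (box_int s k f <= (s ^+ (2 * k))%:E)%E.
Proof.
move=> s0; elim: k f => [|k IH] f f01 /=; first by have /andP[] := f01 [::].
have f0 ps : (0 <= f ps)%E by have /andP[] := f01 ps.
rewrite mulnS exprD expr2 -mulrA -integral_itv_cst//.
apply: ge0_le_integral_nonmeasurable => x _.
  by apply: integral_ge0 => y _; exact: box_int_ge0.
rewrite -integral_itv_cst//; apply: ge0_le_integral_nonmeasurable => y _.
  exact: box_int_ge0.
exact: IH.
Qed.

(** * Close pairs, with the points revealed one at a time *)

Definition close_x (R : realType) (rho : R) (p q : R * R) : R :=
  (`|p.1 - q.1| < rho)%R%:R.

(* Upper bound on the conditional probability, given the first points [qs], that
   points i and j have abscissas closer than rho, if that probability is at most
   [a] while one of them is unknown. *)
Definition pair_weight (R : realType) (rho a : R) (qs : seq (R * R))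
    (ij : nat * nat) : R :=
  if ij.1 == ij.2 then 1
  else if (ij.1 < size qs)%N && (ij.2 < size qs)%N
  then close_x rho (nth (0, 0) qs ij.1) (nth (0, 0) qs ij.2) else a.

Lemma pair_weight_ge0 (R : realType) (rho a : R) qs ij :
  0 <= a -> 0 <= pair_weight rho a qs ij.
Proof. by move=> a0; rewrite /pair_weight; case: ifP => // _; case: ifP => // _; exact: ler0n. Qed.

(** Weights ignore ordinates, so in the lower bound the integral over [y] only contributes a factor
    [s]. *)
Lemma pair_weight_rcons_fst (R : realType) (rho a : R) qs ij x y z :
  pair_weight rho a (rcons qs (x, y)) ij = pair_weight rho a (rcons qs (x, z)) ij.
Proof.
rewrite /pair_weight !size_rcons; case: ifP => // _; case: ifP => // _.
rewrite /close_x !nth_rcons.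
by case: (ij.1 < size qs)%N; case: (ij.1 == size qs);
   case: (ij.2 < size qs)%N; case: (ij.2 == size qs).
Qed.

Lemma integral_indic_ball_le (R : realType) (s rho x0 : R) : 0 <= rho ->
  (\int[@lebesgue_measure R]_(x in `[0%R, s]) (\1_(`]x0 - rho, x0 + rho[%classic) x)%:E
    <= (2 * rho)%:E)%E.
Proof.
move=> rho0; rewrite integral_indic//=.
apply: (@le_trans _ _ (@lebesgue_measure R `]x0 - rho, x0 + rho[%classic)).
  apply: le_measure; rewrite ?inE; [exact: measurableI|exact: measurable_itv|exact: subIsetl].
rewrite lebesgue_measure_itv/= lte_fin; case: ifPn => _; rewrite lee_fin; lra.
Qed.

(** A new point changes the weight of a pair only if it completes a pair of distinct indices. The
    weight [a] then becomes the indicator of an interval around the abscissa of the point already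
    known. *)
Lemma pair_weight_rcons_cases (R : realType) (rho a : R) qs ij :
  (exists x0 : R, (fun x => pair_weight rho a (rcons qs (x, 0)) ij) =
      \1_(`]x0 - rho, x0 + rho[%classic) /\ pair_weight rho a qs ij = a) \/
  (fun x => pair_weight rho a (rcons qs (x, 0)) ij) = cst (pair_weight rho a qs ij).
Proof.
have indE (x x0 : R) :
    (`|x - x0| < rho)%R%:R = (\1_(`]x0 - rho, x0 + rho[%classic) x) :> R.
  by rewrite indicE mem_setE in_itv/= ltr_norml ltrBlDr ltrBrDr !(addrC x0) addrC.
case: ij => i j; rewrite /pair_weight/=.
have [ij|ij] := eqVneq i j; first by right.
have [im|im|im] := ltngtP i (size qs); have [jm|jm|jm] := ltngtP j (size qs).
- right; apply/funext => x; rewrite !size_rcons !nth_rcons im jm.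
  by rewrite !ltnS (ltnW im) (ltnW jm).
- right; apply/funext => x; rewrite !size_rcons.
  by rewrite [(j < _.+1)%N]ltnS [(j <= _)%N]leqNgt jm/= andbF.
- left; exists (nth (0, 0) qs i).1; split => //; apply/funext => x.
  rewrite !size_rcons !ltnS (ltnW im) jm leqnn/= -indE /close_x distrC.
  by rewrite !nth_rcons im -jm ltnn eqxx.
all: try by right; apply/funext => x; rewrite !size_rcons !ltnS [(i <= _)%N]leqNgt im.
- left; exists (nth (0, 0) qs j).1; split => //; apply/funext => x.
  rewrite !size_rcons !ltnS (ltnW jm) im leqnn/= -indE /close_x.
  by rewrite !nth_rcons jm -im ltnn eqxx.
- by right; apply/funext => x; rewrite !size_rcons !ltnS [(j <= _)%N]leqNgt jm/= andbF.
- by move: ij; rewrite im jm eqxx.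
Qed.

Lemma measurable_pair_weight_rcons (R : realType) (rho a : R) qs ij (D : set R) :
  measurable D ->
  measurable_fun D (fun x => pair_weight rho a (rcons qs (x, 0)) ij).
Proof.
move=> mD.
by have [[x0 [-> _]]|->] := pair_weight_rcons_cases rho a qs ij.
Qed.

(** One step of the supermartingale. The value [a = 2 * rho / s] is the length of the interval of
    close abscissas divided by the side of the box. *)
Lemma integral_pair_weight_rcons_le (R : realType) (s rho : R) qs ij :
  0 < s -> 0 <= rho ->
  (\int[@lebesgue_measure R]_(x in `[0%R, s])
      (pair_weight rho (2 * rho / s) (rcons qs (x, 0)) ij)%:E
    <= (s * pair_weight rho (2 * rho / s) qs ij)%:E)%E.
Proof.
move=> s0 rho0; set a := 2 * rho / s.
have [[x0 [e ->]]|e] := pair_weight_rcons_cases rho a qs ij; last first.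
  rewrite -integral_itv_cst ?(ltW s0)//.
  by under eq_integral => x _ do rewrite (congr1 (fun g => g x) e).
under eq_integral => x _ do rewrite (congr1 (fun g => g x) e).
have -> : s * a = 2 * rho by rewrite /a mulrC divfK ?gt_eqF.
exact: integral_indic_ball_le.
Qed.

(** Integrates the bound [c - h <= F] for a possibly nonmeasurable [F], through the measurable
    nonnegative minorant [Num.max 0 (c - h)]. The additive form avoids subtracting an integral that
    could be infinite. *)
Lemma integral_itv_ge_sub (R : realType) (s c : R) (F : R -> \bar R) (h : R -> R) :
  0 <= s -> 0 <= c -> measurable_fun `[0, s] h ->
  (forall x, 0 <= h x) -> (forall x, (0 <= F x)%E) ->
  (forall x, ((c - h x)%:E <= F x)%E) ->
  ((s * c)%:E <= \int[@lebesgue_measure R]_(x in `[0%R, s]) F x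
     + \int[@lebesgue_measure R]_(x in `[0%R, s]) (h x)%:E)%E.
Proof.
move=> s0 c0 mh h0 F0 hF.
pose G (x : R) : \bar R := (Num.max 0 (c - h x))%:E.
have mG : measurable_fun `[0, s] (fun x => Num.max 0 (c - h x)).
  by apply: measurable_maxr => //; exact: measurable_funB.
have G0 x : (0 <= G x)%E by rewrite lee_fin le_max lexx.
apply: (@le_trans _ _ (\int[@lebesgue_measure R]_(x in `[0%R, s]) G x
     + \int[@lebesgue_measure R]_(x in `[0%R, s]) (h x)%:E)%E); last first.
  rewrite leeD2r//; apply: ge0_le_integral_nonmeasurable => // x _.
  by rewrite /G EFin_max ge_max F0 hF.
rewrite -ge0_integralD//; last 3 first.
- exact/measurable_EFinP.
- by move=> x _; rewrite lee_fin.
- exact/measurable_EFinP.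
rewrite -integral_itv_cst//; apply: ge0_le_integral_nonmeasurable => x _.
  by rewrite lee_fin.
by rewrite /G -EFinD lee_fin -lerBlDr le_max lexx orbT.
Qed.

(* The sum of weights is a supermartingale in the revealed prefix [qs]. *)
Lemma box_int_ge_pair_weight (R : realType) (s rho beta : R) (L : seq (nat * nat))
    (k : nat) (f : seq (R * R) -> \bar R) (qs : seq (R * R)) :
  0 < s -> 0 <= rho -> 0 <= beta -> (forall ps, (0 <= f ps)%E) ->
  (forall ps, size ps = k ->
    ((1 - beta * \sum_(ij <- L) pair_weight rho (2 * rho / s) (qs ++ ps) ij)%:E
      <= f ps)%E) ->
  ((s ^+ (2 * k) * (1 - beta * \sum_(ij <- L) pair_weight rho (2 * rho / s) qs ij))%:E
    <= box_int s k f)%E.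
Proof.
move=> s0 rho0 beta0; set a := 2 * rho / s.
have a0 : 0 <= a by rewrite /a divr_ge0 ?mulr_ge0// ltW.
elim: k f qs => [|k IH] f qs f0 fle /=.
  by have := fle [::] erefl; rewrite cats0 muln0 expr0 mul1r.
pose S ps := \sum_(ij <- L) pair_weight rho a ps ij.
have S0 ps : 0 <= S ps by apply: sumr_ge0 => ij _; exact: pair_weight_ge0.
(* [c - h x] is the induction hypothesis for the prefix extended by a point of abscissa [x],
   integrated over its ordinate; the ordinate 0 in [h] is a placeholder. *)
pose c := s ^+ (2 * k) * s.
have c0 : 0 <= c by rewrite mulr_ge0 ?exprn_ge0 ?ltW.
pose h x := c * beta * S (rcons qs (x, 0)).
have h0 x : 0 <= h x by rewrite mulr_ge0// mulr_ge0.
have mS : measurable_fun `[0, s] (fun x => S (rcons qs (x, 0))).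
  by apply: measurable_sum => ij; exact: measurable_pair_weight_rcons.
have mh : measurable_fun `[0, s] h.
  by apply: measurable_funM => //; exact: measurable_cst.
set F := fun x => (\int[lebesgue_measure]_(y in _) _)%E.
have F0 x : (0 <= F x)%E by apply: integral_ge0 => y _; exact: box_int_ge0.
have hF x : ((c - h x)%:E <= F x)%E.
  have -> : c - h x = s * (s ^+ (2 * k) * (1 - beta * S (rcons qs (x, 0)))).
    by rewrite /h /c; ring.
  set d := s ^+ (2 * k) * _.
  (* [d] may be negative, while monotonicity of the integral is available for nonnegative
     integrands. *)
  apply: (@le_trans _ _ (s * Num.max 0 d)%:E).
    by rewrite lee_fin ler_wpM2l ?(ltW s0)// le_max lexx orbT.
  rewrite -integral_itv_cst ?(ltW s0)//.
  apply: ge0_le_integral_nonmeasurable => y _; first by rewrite lee_fin le_max lexx.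
  rewrite EFin_max ge_max box_int_ge0//=.
  have -> : d = s ^+ (2 * k) * (1 - beta * S (rcons qs (x, y))).
    rewrite /d; congr (_ * (1 - _ * _)).
    by apply: eq_bigr => ij _; exact: pair_weight_rcons_fst.
  by apply: IH => // ps sz; rewrite cat_rcons; apply: fle => /=; rewrite sz.
have := integral_itv_ge_sub (ltW s0) c0 mh h0 F0 hF.
have hle : (\int[@lebesgue_measure R]_(x in `[0%R, s]) (h x)%:E
    <= (c * beta * (s * S qs))%:E)%E.
  rewrite /h; under eq_integral do rewrite EFinM.
  rewrite ge0_integralZl_EFin//; last 3 first.
  - by move=> x _; rewrite lee_fin.
  - exact/measurable_EFinP.
  - exact: mulr_ge0.
  rewrite [leRHS]EFinM lee_wpmul2l ?lee_fin ?(mulr_ge0 c0)//.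
  rewrite /S; under eq_integral do rewrite -sumEFin.
  rewrite ge0_integral_sum//; last 2 first.
  - by move=> ij; apply/measurable_EFinP; exact: measurable_pair_weight_rcons.
  - by move=> ij x _; rewrite lee_fin pair_weight_ge0.
  rewrite mulr_sumr -sumEFin; apply: lee_sum => ij _.
  exact: integral_pair_weight_rcons_le.
move=> /le_trans /(_ (leeD2l _ hle)).
rewrite -leeBlDr// -EFinB; apply: le_trans; rewrite lee_fin /c -/(S qs).
by rewrite mulnS exprD expr2 le_eqVlt; apply/orP; left; apply/eqP; ring.
Qed.

(** * Deterministic rate bound for a fixed configuration *)

(** The right-hand side is the critical hop length d_c, obtained by taking the [alpha]-th root of
    the SNR constraint; an abscissa gap is at most the distance. *)
Lemma hop_ok_le (R : realType) (P P0 alpha : R) (Psi : nat) (p q : R * R) :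
  0 < P -> 0 < P0 -> 0 < alpha -> hop_ok P P0 alpha Psi p q ->
  `|p.1 - q.1| <= (P / P0) `^ alpha^-1 * Psi%:R `^ (2 / alpha).
Proof.
move=> P_gt0 P0_gt0 alpha_gt0; rewrite /hop_ok; set D := dist2 p q => hop.
have D_ge0 : 0 <= D by exact: sqrtr_ge0.
have xD : `|p.1 - q.1| <= D.
  by rewrite -sqrtr_sqr ler_sqrt ?lerDl ?addr_ge0 ?sqr_ge0.
apply: (le_trans xD).
have DP : D `^ alpha <= P / P0 * Psi%:R `^ 2.
  rewrite (powR_mulrn 2) ?ler0n// mulrAC ler_pdivlMr// mulrC.
  by apply: le_trans hop; rewrite ler_wpM2l ?(ltW P0_gt0)// le_max lexx orbT.
rewrite powRrM -powRM ?powR_ge0 ?divr_ge0 ?(ltW P_gt0) ?(ltW P0_gt0)//.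
have -> : D = (D `^ alpha) `^ alpha^-1 by rewrite -powRrM mulfV ?gt_eqF// powRr1.
apply: ge0_ler_powR => //; first by rewrite invr_ge0 ltW.
- by rewrite nnegrE powR_ge0.
- by rewrite nnegrE mulr_ge0 ?powR_ge0 ?divr_ge0 ?ltW.
Qed.

Lemma path_displacement_le (R : numDomainType) (T : Type) (X : T -> R) (d : R)
    (e : rel T) (x : T) (p : seq T) :
  (forall a b, e a b -> `|X a - X b| <= d) -> path e x p ->
  `|X x - X (last x p)| <= (size p)%:R * d.
Proof.
move=> ed; elim: p x => [|y p IH] x /=; first by rewrite subrr normr0 mul0r.
move=> /andP[/ed xy /IH yp].
by rewrite -natr1 mulrDl mul1r [leRHS]addrC (le_trans (ler_distD (X y) _ _))// lerD.
Qed.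

Lemma sum_count_mem (T : finType) (s : seq T) :
  (\sum_(x : T) count_mem x s)%N = size s.
Proof.
elim: s => [|y s IH] /=; first by rewrite big1.
rewrite big_split/= IH (bigD1 y)//= eqxx big1 ?addn0//.
by move=> x xy; rewrite eq_sym (negbTE xy).
Qed.

(* Total transmission rate: the hops of the pairs whose ends are at abscissa
   distance at least [rho] number at least [rho / d] each. *)
Lemma worst_rate_le_of_few_close (R : realType) (k : nat) (s : 'S_k)
    (ps : seq (R * R)) (P P0 alpha : R) (Psi : nat) (C rho : R) :
  0 < P -> 0 < P0 -> 0 < alpha -> (0 < Psi)%N -> 0 < C -> 0 < rho ->
  2 * \sum_(i < k) close_x rho (nth (0, 0) ps i) (nth (0, 0) ps (s i)) < k%:R ->
  worst_rate_le s ps P P0 alpha Psi C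
    (2 * C * (P / P0) `^ alpha^-1 * Psi%:R `^ (2 / alpha) / rho).
Proof.
move=> P_gt0 P0_gt0 alpha_gt0 Psi_gt0 C_gt0 rho_gt0.
set N := \sum_(i < k) _ => Nk route r [hop r_ge0 cap].
set d := (P / P0) `^ alpha^-1 * Psi%:R `^ (2 / alpha).
have d_gt0 : 0 < d by rewrite mulr_gt0// powR_gt0 ?divr_gt0 ?ltr0n.
(* Suppose that every rate exceeds [t]; the capacity constraints will be violated in total. *)
set t := _ / rho; have tE : t * rho = 2 * C * d by rewrite divfK ?gt_eqF// mulrA.
have t_gt0 : 0 < t by rewrite -(pmulr_lgt0 _ rho_gt0) tE mulr_gt0// mulr_gt0.
apply: contrapT => /forallNP r_gt.
have tr (i : 'I_k) : t <= r i by rewrite leNgt; apply/negP => /ltW; exact: r_gt.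
have total : \sum_(i < k) r i * (size (route i))%:R <= k%:R * C.
  have -> : k%:R * C = \sum_(j < k) C by rewrite sumr_const card_ord mulr_natl.
  apply: le_trans (ler_sum _ (fun j _ => cap j)).
  rewrite exchange_big/=; apply: ler_sum => i _.
  by rewrite -mulr_sumr -natr_sum sum_count_mem size_belast.
(* The factor [1 - close_x] makes the bound trivial for close pairs, so that all pairs can be summed
   at once. *)
have far (i : 'I_k) : rho * (1 - close_x rho (nth (0, 0) ps i) (nth (0, 0) ps (s i)))
    <= (size (route i))%:R * d.
  have [pth lst] := hop i.
  have := @path_displacement_le R _ (fun j : 'I_k => (nth (0, 0) ps j).1) d _ _ _ _ pth.
  rewrite lst => /(_ (fun a b => hop_ok_le P_gt0 P0_gt0 alpha_gt0)).
  apply: le_trans; rewrite /close_x; case: ltP => h /=.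
    by rewrite subrr mulr0.
  by rewrite subr0 mulr1.
(* Since [t * rho = 2 * C * d], this reduces to [2 * (k - N) <= k], against [2 * N < k]. *)
have : t * rho * (k%:R - N) <= d * (k%:R * C).
  have -> : k%:R - N = \sum_(i < k) (1 - close_x rho (nth (0, 0) ps i) (nth (0, 0) ps (s i))).
    by rewrite sumrB sumr_const card_ord.
  apply: (@le_trans _ _ (d * (\sum_(i < k) r i * (size (route i))%:R))); last first.
    by rewrite ler_wpM2l// ltW.
  rewrite !mulr_sumr; apply: ler_sum => i _.
  rewrite -mulrA (le_trans (ler_wpM2l (ltW t_gt0) (far i)))//.
  by rewrite [leLHS]mulrA [leRHS]mulrC ler_pM2r// ler_wpM2r.
rewrite tE => le2.
have : C * d * (2 * (k%:R - N)) <= C * d * k%:R.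
  by move: le2; congr (_ <= _); ring.
rewrite (ler_pM2l (mulr_gt0 C_gt0 d_gt0)) => le3; lra.
Qed.

(** * Markov's inequality for a fixed number of stations and a fixed pairing *)

Lemma sum_pair_weight_nil_le (R : realType) (rho a : R) (k : nat) (s : 'S_k) :
  0 <= a ->
  \sum_(i < k) pair_weight rho a [::] (i : nat, s i : nat)
    <= #|[set i | s i == i]%SET|%:R + k%:R * a.
Proof.
move=> a_ge0.
have -> : k%:R * a = \sum_(i < k) a by rewrite sumr_const card_ord mulr_natl.
rewrite -sum1dep_card natr_sum [X in X + _]big_mkcond/= -big_split/=.
apply: ler_sum => i _; rewrite /pair_weight/= eq_sym.
by rewrite -(inj_eq val_inj) /=; case: eqP => _; rewrite ?lerDl ?add0r.
Qed.

(** Markov's inequality at the threshold [k / 2], whence the factor [2 / k]. The number of fixed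
    points is kept explicit, to be averaged over [s] later. *)
Lemma box_int_worst_rate_ge (R : realType) (k : nat) (s : 'S_k)
    (P P0 alpha : R) (Psi : nat) (C rho side : R) :
  0 < P -> 0 < P0 -> 0 < alpha -> (0 < Psi)%N -> 0 < C -> 0 < rho -> 0 < side ->
  (0 < k)%N ->
  ((side ^+ (2 * k) * (1 - 2 / k%:R * #|[set i | s i == i]%SET|%:R
      - 2 * (2 * rho / side)))%:E
    <= box_int side k (fun ps => (`[< worst_rate_le s ps P P0 alpha Psi C
        (2 * C * (P / P0) `^ alpha^-1 * Psi%:R `^ (2 / alpha) / rho) >]%:R)%:E))%E.
Proof.
move=> P_gt0 P0_gt0 alpha_gt0 Psi_gt0 C_gt0 rho_gt0 side_gt0 k_gt0.
have k_gt0' : 0 < k%:R :> R by rewrite ltr0n.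
set a := 2 * rho / side.
have a_ge0 : 0 <= a by rewrite divr_ge0 ?mulr_ge0 ?ltW.
pose L := [seq (i : nat, s i : nat) | i : 'I_k <- index_enum 'I_k].
have LE ps : \sum_(ij <- L) pair_weight rho a ps ij =
    \sum_(i < k) pair_weight rho a ps (i : nat, s i : nat) by rewrite big_map.
have beta_ge0 : 0 <= 2 / k%:R :> R by rewrite divr_ge0.
apply: le_trans (@box_int_ge_pair_weight R side rho (2 / k%:R) L k _ [::]
  side_gt0 (ltW rho_gt0) beta_ge0 _ _).
- rewrite lee_fin ler_wpM2l ?exprn_ge0 ?(ltW side_gt0)// -addrA -opprD lerD2l lerN2.
  rewrite LE (le_trans (ler_wpM2l beta_ge0 (@sum_pair_weight_nil_le _ rho a k s a_ge0)))//.
  by rewrite mulrDr lerD2l mulrA divfK ?gt_eqF.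
- by move=> ps; rewrite lee_fin ler0n.
move=> ps psk; rewrite lee_fin -/a LE cat0s.
set M := \sum_(i < k) _.
pose N := \sum_(i < k) close_x rho (nth (0, 0) ps i) (nth (0, 0) ps (s i)).
have NM : N <= M.
  apply: ler_sum => i _; rewrite /pair_weight/= psk !ltn_ord/=.
  by case: eqP => // _; rewrite /close_x; case: ltP.
(* Either few pairs are close and the rate event holds, or the minorant is at most 0. *)
have [Nk|Nk] := ltP (2 * N) k%:R.
  rewrite asboolT ?gerBl//=; first by rewrite mulr_ge0// sumr_ge0// => i _; exact: pair_weight_ge0.
  exact: worst_rate_le_of_few_close.
apply: (@le_trans _ _ 0); last exact: ler0n.
by rewrite subr_le0 mulrAC ler_pdivlMr// mul1r (le_trans Nk)// ler_wpM2l.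
Qed.

(** * Poisson weights *)

Definition poisson_weight (R : realType) (m : R) (k : nat) : R :=
  expR (- m) * m ^+ k / (k`!)%:R.

Lemma poisson_weight_ge0 (R : realType) (m : R) k : 0 <= m -> 0 <= poisson_weight m k.
Proof. by move=> m0; rewrite divr_ge0// mulr_ge0 ?expR_ge0 ?exprn_ge0. Qed.

Lemma cvg_series_poisson_weight (R : realType) (m : R) :
  series (poisson_weight m) @ \oo --> (1 : R).
Proof.
have -> : series (poisson_weight m) = (fun n => expR (- m) * series (exp_coeff m) n).
  apply/funext => n; rewrite /series/= mulr_sumr; apply: eq_bigr => k _.
  by rewrite /poisson_weight /exp_coeff/= mulrA.
have -> : 1 = expR (- m) * expR m by rewrite -expRD addNr expR0.
apply: cvgMr; exact: is_cvg_series_exp_coeff.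
Qed.

Lemma series_poisson_weight_le1 (R : realType) (m : R) n :
  0 <= m -> series (poisson_weight m) n <= 1.
Proof.
move=> m0; have cv := @cvg_series_poisson_weight R m.
rewrite -(cvg_lim _ cv)//; apply: nondecreasing_cvgn_le; last by apply/cvg_ex; exists 1.
by apply: nondecreasing_series => k _ _; exact: poisson_weight_ge0.
Qed.

(* Uses 1/k <= 2/(k+1); summed over k this bounds E[2/k; k > 0] by 4/m. *)
Lemma poisson_weight_div_le (R : realType) (m : R) k : 0 < m -> (0 < k)%N ->
  2 / k%:R * poisson_weight m k <= 4 / m * poisson_weight m k.+1.
Proof.
move=> m0 k0.
have k0' : 1 <= k%:R :> R by rewrite ler1n.
have -> : 4 / m * poisson_weight m k.+1 = 4 / (k.+1)%:R * poisson_weight m k.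
  rewrite /poisson_weight factS natrM exprS; field.
  by rewrite !gt_eqF ?ltr0n ?fact_gt0.
rewrite ler_wpM2r ?poisson_weight_ge0 ?(ltW m0)//.
rewrite ler_pdivrMr ?ltr0n// mulrAC ler_pdivlMr ?ltr0n// -natr1; lra.
Qed.

Lemma sum_perm_fixed_points (R : realType) (k : nat) : (0 < k)%N ->
  \sum_(s : 'S_k) #|[set i | s i == i]%SET|%:R = (k`!)%:R :> R.
Proof. by move=> k0; rewrite -natr_sum sum_fixed_points_perm card_ord. Qed.

(** * Averaging over the pairing and the number of stations *)

(** The volume [n ^ k] and the [k!] permutations cancel the normalisation, leaving partial sums of
    Poisson weights. This is the upper side of the final squeeze. *)
Lemma ppp_perm_prob_le1 (R : realType) (lam : R) n
    (E : forall k : nat, 'S_k -> seq (R * R) -> Prop) :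
  0 < lam -> (0 < n)%N -> (ppp_perm_prob lam n E <= 1)%E.
Proof.
move=> lam0 n0.
have m0 : 0 <= lam * n%:R by rewrite mulr_ge0// ltW.
have w0 k := @poisson_weight_ge0 R (lam * n%:R) k m0.
have nk0 k : 0 < n%:R ^+ k :> R by rewrite exprn_gt0// ltr0n.
have wn0 k : 0 <= poisson_weight (lam * n%:R) k / (k`!)%:R / n%:R ^+ k.
  by apply: divr_ge0; [apply: divr_ge0 | exact: ltW].
rewrite /ppp_perm_prob; apply: lime_le.
  apply: is_cvg_nneseries => k _ _; apply: mule_ge0.
    by rewrite lee_fin; exact: wn0.
  by apply: sume_ge0 => s _; apply: box_int_ge0 => ps; rewrite lee_fin ler0n.
apply: nearW => M.
apply: (@le_trans _ _ (series (poisson_weight (lam * n%:R)) M)%:E); last first.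
  by rewrite lee_fin series_poisson_weight_le1.
rewrite /series/= -sumEFin; apply: lee_sum => k _.
rewrite -/(poisson_weight (lam * n%:R) k).
have -> : (poisson_weight (lam * n%:R) k)%:E =
   ((poisson_weight (lam * n%:R) k / (k`!)%:R / n%:R ^+ k)%:E
     * \sum_(s : 'S_k) (n%:R ^+ k)%:E)%E.
  rewrite sumEFin -EFinM sumr_const card_Sn -[_ *+ k`!]mulr_natr; congr (_%:E).
  by field; rewrite !gt_eqF ?ltr0n ?fact_gt0 ?nk0.
apply: lee_wpmul2l; first by rewrite lee_fin wn0.
apply: lee_sum => s _.
have -> : n%:R ^+ k = Num.sqrt n%:R ^+ (2 * k) :> R by rewrite exprM sqr_sqrtr.
by apply: box_int_le1 => [|ps]; rewrite ?sqrtr_ge0// !lee_fin ler0n lern1 leq_b1.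
Qed.

(** Averaging over [s] replaces the number of fixed points by 1; the remaining loss [2 / k] averages
    to at most [4 / m] under the Poisson law of mean [m = lam * n]. *)
Lemma ppp_perm_prob_ge (R : realType) (lam b : R) n
    (E : forall k : nat, 'S_k -> seq (R * R) -> Prop) :
  0 < lam -> (0 < n)%N -> 0 <= b ->
  (forall k (s : 'S_k), (0 < k)%N ->
    ((Num.sqrt n%:R ^+ (2 * k) * (1 - 2 / k%:R * #|[set i | s i == i]%SET|%:R - b))%:E
     <= box_int (Num.sqrt n%:R) k (fun ps => (`[< E k s ps >]%:R)%:E))%E) ->
  ((1 - b - 4 / (lam * n%:R))%:E <= ppp_perm_prob lam n E)%E.
Proof.
move=> lam0 n0 b0 hE.
set m := lam * n%:R.
have m0 : 0 < m by rewrite mulr_gt0// ltr0n.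
have w0 k := @poisson_weight_ge0 R m k (ltW m0).
have nk0 k : 0 < n%:R ^+ k :> R by rewrite exprn_gt0// ltr0n.
have wn0 k : 0 <= poisson_weight (m) k / (k`!)%:R / n%:R ^+ k.
  by apply: divr_ge0; [apply: divr_ge0 | exact: ltW].
have fk0 k : 0 < k`!%:R :> R by rewrite ltr0n fact_gt0.
pose u k : \bar R := ((poisson_weight m k / (k`!)%:R / n%:R ^+ k)%:E
  * \sum_(s : 'S_k) box_int (Num.sqrt n%:R) k (fun ps => (`[< E k s ps >]%:R)%:E))%E.
rewrite -[ppp_perm_prob _ _ _]/(\sum_(0 <= k <oo) u k)%E.
have u0 k : (0 <= u k)%E.
  apply: mule_ge0; first by rewrite lee_fin; exact: wn0.
  by apply: sume_ge0 => s _; apply: box_int_ge0 => ps; rewrite lee_fin ler0n.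
have ule k : ((poisson_weight m k * (1 - b) - 4 / m * poisson_weight m k.+1)%:E <= u k)%E.
  case: k => [|k].
    (* With no station the lower bound is at most 0, because [4 / m] times the weight of 1 is 4
       times the weight of 0. *)
    apply: le_trans (u0 _); rewrite lee_fin subr_le0.
    have -> : 4 / m * poisson_weight m 1 = 4 * poisson_weight m 0.
      by rewrite /poisson_weight expr1 expr0 !fact0 !factS fact0; field; rewrite gt_eqF.
    have := w0 0%N; nra.
  set K := k.+1; have K0 : (0 < K)%N by [].
  apply: (@le_trans _ _ (poisson_weight m K * (1 - b) - 2 / K%:R * poisson_weight m K)%:E).
    by rewrite lee_fin lerD2l lerN2 poisson_weight_div_le.
  apply: (@le_trans _ _ ((poisson_weight m K / (K`!)%:R / n%:R ^+ K)%:E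
     * \sum_(s : 'S_K) (Num.sqrt n%:R ^+ (2 * K) *
         (1 - 2 / K%:R * #|[set i | s i == i]%SET|%:R - b))%:E)%E); last first.
    apply: lee_wpmul2l; first by rewrite lee_fin wn0.
    by apply: lee_sum => s _; exact: hE.
  rewrite sumEFin -EFinM lee_fin -mulr_sumr sumrB sumrB -mulr_sumr.
  rewrite sum_perm_fixed_points// !sumr_const card_Sn -[b *+ _]mulr_natr.
  rewrite exprM sqr_sqrtr// le_eqVlt; apply/orP; left; apply/eqP; field.
  by rewrite !gt_eqF ?nk0 ?fk0 ?ltr0n.
(* The subtracted sums are replaced by their bounds [b] and [4 / m], so only the main sum depends on
   [M], and it tends to 1. *)
have part M : ((series (poisson_weight m) M - b - 4 / m)%:E <= \sum_(0 <= k <oo) u k)%E.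
  apply: le_trans (nneseries_lim_ge M _); last by move=> k _ _; exact: u0.
  apply: (@le_trans _ _ (\sum_(0 <= k < M)
      (poisson_weight m k * (1 - b) - 4 / m * poisson_weight m k.+1)%:E)%E); last first.
    by apply: lee_sum => k _; exact: ule.
  rewrite sumEFin lee_fin sumrB -mulr_suml -mulr_sumr.
  have W1 : \sum_(0 <= k < M) poisson_weight m k <= 1.
    exact: series_poisson_weight_le1 (ltW m0).
  have W2 : \sum_(0 <= k < M) poisson_weight m k.+1 <= 1.
    have := @series_poisson_weight_le1 R m M.+1 (ltW m0).
    rewrite /series/= big_nat_recl//; apply: le_trans; by rewrite lerDr.
  rewrite /series/= -addrA mulrBr mulr1 -addrA lerD2l lerD//.
    by rewrite lerN2 ler_piMl.
  by rewrite lerN2 ler_piMr// divr_ge0// ltW.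
have cv : (series (poisson_weight m) M - b - 4 / m)%:E @[M --> \oo] --> (1 - b - 4 / m)%:E.
  apply/cvg_EFin; first by near=> x.
  apply: cvgB; last exact: cvg_cst.
  apply: cvgB; last exact: cvg_cst.
  exact: cvg_series_poisson_weight.
rewrite -(cvg_lim _ cv)//; apply: lime_le; first by apply/cvg_ex; eexists; exact: cv.
exact: nearW.
Unshelve. all: by end_near.
Qed.

(** * Limits in [n] and the rate bound *)

Lemma cvg_natV (R : realType) : (n%:R^-1 : R) @[n --> \oo] --> (0 : R).
Proof. by rewrite -(cvg_shiftS (fun n : nat => n%:R^-1 : R)); exact: cvg_harmonic. Qed.

Lemma cvg_natN_powR (R : realType) (e : R) : 0 < e ->
  (n%:R `^ (- e) : R) @[n --> \oo] --> (0 : R).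
Proof.
move=> e0; rewrite -(cvg_shiftS (fun n : nat => n%:R `^ (- e) : R)).
have -> : (fun n : nat => n.+1%:R `^ (- e) : R) = (fun n => harmonic n `^ e).
  by apply/funext => n; rewrite /harmonic/= -powR_inv1// -powRrM mulN1r.
apply: (@cvg_comp _ _ _ (@harmonic R) (fun x => x `^ e) _ (0 : R)^'+); last exact: powR_cvg0.
move=> A /= [d d0 dA]; have /cvgrPdist_lt/(_ _ d0) := @cvg_harmonic R.
by apply: filterS => n /= h; apply: dA => //=; rewrite invr_gt0 ltr0n.
Qed.

Theorem theorem2 (R : realType) (lam P P0 alpha C eps : R) (Psi : nat -> nat) :
  0 < lam -> 0 < P -> 0 < P0 -> 2 < alpha -> 0 < C ->
  {homo Psi : m n / (m <= n)%N} -> (forall n, (0 < Psi n)%N) ->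
  0 < eps ->
  exists K : R,
    (fun n : nat =>
       ppp_perm_prob lam n (fun k s ps =>
         worst_rate_le s ps P P0 alpha (Psi n) C
           (K * ((Psi n)%:R `^ (2 / alpha)) / (n%:R `^ (2^-1 - eps)))))
      @ \oo --> 1%E.
Proof.
move=> lam_gt0 P_gt0 P0_gt0 alpha_gt2 C_gt0 _ Psi_gt0 eps_gt0.
have alpha_gt0 : 0 < alpha by lra.
exists (2 * C * (P / P0) `^ alpha^-1).
(* The first loss comes from close pairs, the second from fixed points of the pairing. *)
pose lower n : R := 1 - 4 * n%:R `^ (- eps) - 4 / lam * n%:R^-1.
apply: (@squeeze_cvge _ _ _ _ (EFin \o lower) _ (cst 1%E)); last exact: cvg_cst.
  near=> n.
  have n_gt0 : (0 < n)%N by near: n; exact: nbhs_infty_gt.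
  have n_gt0' : 0 < n%:R :> R by rewrite ltr0n.
  apply/andP; split; last exact: ppp_perm_prob_le1.
  set rho := n%:R `^ (2^-1 - eps).
  have rho_gt0 : 0 < rho by rewrite powR_gt0.
  have side_gt0 : 0 < Num.sqrt n%:R :> R by rewrite sqrtr_gt0.
  (* This is the Markov loss [b]: twice the probability bound for one close pair. *)
  have rhoE : 2 * (2 * rho / Num.sqrt n%:R) = 4 * n%:R `^ (- eps).
    rewrite /rho powRD; last by rewrite (gt_eqF n_gt0') implybT.
    by rewrite powR12_sqrt ?ler0n//; field; rewrite gt_eqF.
  rewrite /= /lower -rhoE.
  have -> : 4 / lam * n%:R^-1 = 4 / (lam * n%:R).
    by rewrite invfM mulrA.
  apply: ppp_perm_prob_ge => //.
    by rewrite rhoE mulr_ge0 ?powR_ge0.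
  by move=> k s k_gt0; exact: box_int_worst_rate_ge.
apply/cvg_EFin; first by near=> n.
rewrite -[1]subr0 -[X in X - 0]subr0 -[X in _ - X - _](mulr0 4) -[X in _ - X](mulr0 (4 / lam)).
apply: cvgB; first apply: cvgB; first exact: cvg_cst.
  apply: cvgMr; exact: cvg_natN_powR.
apply: cvgMr; exact: cvg_natV.
Unshelve. all: by end_near.
Qed.
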